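(* Let $U_L=(h_L,u_L,a_L)\in A_2\cup A_3$ and $U_R=(h_R,u_R,a_R)$ with $a_L<a_R$. Let $\{U_+\}=\mathcal W_1(U_L)\cap\mathcal C_+$, $\{U_1\}=SW(U_+,a_R)\cap A_1$ and $\{U_2\}=\mathcal W_1(U_1)\cap\mathcal W_2^B(U_R)$, where $U_1=(h_1,u_1,a_R)$, $U_2=(h_2,u_2,a_R)$ (these states being assumed to exist). Let $\tilde h_1$ be the $h$-component of the state $\tilde U_1$ associated with $U_1\in A_1$. If $h_2\le\tilde h_1$, then the Riemann problem for the shallow water equations with data $(U_L,U_R)$ has an admissible solution with the structure $$R_1(U_L,U_+)\oplus W_3(U_+,U_1)\oplus W_1(U_1,U_2)\oplus W_2(U_2,U_R),$$ where $R_1(U_L,U_+)$ is a 1-rarefaction wave.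
   Context: System: $\partial_t h+\partial_x(hu)=0$, $\partial_t(hu)+\partial_x\big(h(u^2+g h/2)\big)=-gh\,\partial_x a$, $\partial_t a=0$, with $g>0$ constant, state $U=(h,u,a)$, $h>0$. The Riemann problem with data $(U_L,U_R)$ has initial condition $U_L$ for $x<0$ and $U_R$ for $x>0$. Characteristic speeds: $\lambda_1(U)=u-\sqrt{gh}$, $\lambda_2(U)=u+\sqrt{gh}$, $\lambda_3(U)=0$. Regions: $A_1=\{\lambda_2>\lambda_1>0\}$, $A_2=\{\lambda_2>0>\lambda_1\}$, $A_3=\{0>\lambda_2>\lambda_1\}$; $\mathcal C_\pm=\{u=\pm\sqrt{gh}\}$, $\mathcal C=\mathcal C_+\cup\mathcal C_-$. Wave curves (all with $a=a_0$ fixed, $h>0$), for $U_0=(h_0,u_0,a_0)$. $\mathcal W_1(U_0)$ is the set of right-hand states $(h,u,a_0)$ with $u=u_0-\sqrt{g/2}\,(h-h_0)\sqrt{1/h+1/h_0}$ if $h>h_0$ (1-shock) and $u=u_0-2\sqrt g(\sqrt h-\sqrt{h_0})$ if $h\le h_0$ (1-rarefaction). $\mathcal W_2^B(U_0)$ is the set of left-hand states $(h,u,a_0)$ with $u=u_0+\sqrt{g/2}\,(h-h_0)\sqrt{1/h+1/h_0}$ if $h>h_0$ (2-shock) and $u=u_0+2\sqrt g(\sqrt h-\sqrt{h_0})$ if $h\le h_0$ (2-rarefaction). A shock joining $U_0$ and $U$ has speed $\bar\lambda=(hu-h_0u_0)/(h-h_0)$; an $i$-rarefaction from $U$ to $V$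 occupies the speeds $[\lambda_i(U),\lambda_i(V)]$. For $U\in A_1$, $\tilde U$ denotes the unique state on the 1-shock part ($\tilde h>h$) of $\mathcal W_1(U)$ for which the shock speed between $U$ and $\tilde U$ is $0$; $\tilde h$ is its $h$-component. Stationary waves: a stationary wave (speed $0$) joins $U_0$ to $U$ when $hu=h_0u_0$ and $\frac{u^2}{2}+g(h+a)=\frac{u_0^2}{2}+g(h_0+a_0)$. For $u_0\ne0$ let $\varphi(h)=a_0-a+\frac{u_0^2}{2g}\big(\frac{h_0^2}{h^2}-1\big)+h-h_0$, $h_{\min}(U_0)=(u_0^2h_0^2/g)^{1/3}$ and $a_{\min}(U_0)=a_0+\frac{u_0^2}{2g}\big(\frac{h_0^2}{h_{\min}^2}-1\big)+h_{\min}-h_0$; if $a\ge a_{\min}(U_0)$, let $h_*\le h_{\min}\le h^*$ be the roots of $\varphi$ in $(0,\infty)$. $SW(U_0,a)$ is the state $(h,h_0u_0/h,a)$ with $h=h_*$ if $U_0\in A_1\cup A_3$ and $h=h^*$ if $U_0\in A_2$, $u_0\neq 0$; if $U_0\in\mathcal C$ both values $h_*,h^*$ are allowed, so $SW(U_0,a)$ is then a set of two states; if $u_0=0$, $SW(U_0,a)=(h_0+a_0-a,0,a)$ (when $h_0+a_0-a>0$). $W_i(U,V)$ denotes the (possibly trivial) $i$-wave with left state $U$ and right state $V$: a Lax shock or rarefaction for $i=1,2$, a stationary wave for $i=3$. $W_i(U,V)\oplus W_j(V,Z)$ means that $W_i(U,V)$ is followed by $W_j(V,Z)$. Such a concatenation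 from $U_L$ to $U_R$ is an admissible solution of the Riemann problem when each wave is admissible, the waves can be placed in this order from left to right in the $(x,t)$-plane (all speeds in each wave are $\le$ all speeds in the next wave), and the Monotonicity Criterion holds: along each stationary wave, $a$ varies monotonically in $h$ on the curve $h\mapsto\big(u=\frac{h_0u_0}{h},\,a=a_0+\frac{u^2-u_0^2}{2g}+h-h_0\big)$, and the total variation of $a$ in the solution is $|a_L-a_R|$.
   Formalization: For u_0≠0 a stationary wave means hu=h_0u_0 and a=a_0+(u²-u_0²)/(2g)+h-h_0 (the relation φ=0 of SW and the Monotonicity Criterion), not conservation of u²/2+g(h+a): the two have opposite signs in a and together force a=a_0, so the literal claim fails whenever a_L<a_R. *)

(* Defs.v *)
From Stdlib Require Export Reals List.
Export ListNotations.
Local Open Scope R_scope.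

Record state := mkState { height : R; velocity : R; bottom : R }.

Definition lambda1 (g : R) (U : state) : R := velocity U - sqrt (g * height U).
Definition lambda2 (g : R) (U : state) : R := velocity U + sqrt (g * height U).

Definition A1 (g : R) (U : state) : Prop :=
  0 < height U /\ 0 < lambda1 g U < lambda2 g U.
Definition A2 (g : R) (U : state) : Prop :=
  0 < height U /\ lambda1 g U < 0 < lambda2 g U.
Definition A3 (g : R) (U : state) : Prop :=
  0 < height U /\ lambda1 g U < lambda2 g U < 0.

Definition C_plus (g : R) (U : state) : Prop :=
  0 < height U /\ velocity U = sqrt (g * height U).
Definition C_minus (g : R) (U : state) : Prop :=
  0 < height U /\ velocity U = - sqrt (g * height U).
Definition C_sonic (g : R) (U : state) : Prop := C_plus g U \/ C_minus g U.

(** * Wave curves *)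

Definition shock_curve1 (g : R) (U0 U : state) : Prop :=
  height U0 < height U /\ bottom U = bottom U0 /\
  velocity U = velocity U0
    - sqrt (g / 2) * (height U - height U0) * sqrt (1 / height U + 1 / height U0).
Definition rarefaction_curve1 (g : R) (U0 U : state) : Prop :=
  0 < height U <= height U0 /\ bottom U = bottom U0 /\
  velocity U = velocity U0 - 2 * sqrt g * (sqrt (height U) - sqrt (height U0)).

(** Right-hand states [U] reached from the left-hand state [U0]. *)
Definition W1 (g : R) (U0 U : state) : Prop :=
  0 < height U /\ (shock_curve1 g U0 U \/ rarefaction_curve1 g U0 U).

Definition shock_curve2B (g : R) (U0 U : state) : Prop :=
  height U0 < height U /\ bottom U = bottom U0 /\
  velocity U = velocity U0
    + sqrt (g / 2) * (height U - height U0) * sqrt (1 / height U + 1 / height U0).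
Definition rarefaction_curve2B (g : R) (U0 U : state) : Prop :=
  0 < height U <= height U0 /\ bottom U = bottom U0 /\
  velocity U = velocity U0 + 2 * sqrt g * (sqrt (height U) - sqrt (height U0)).

(** Left-hand states [U] from which the right-hand state [U0] is reached. *)
Definition W2B (g : R) (U0 U : state) : Prop :=
  0 < height U /\ (shock_curve2B g U0 U \/ rarefaction_curve2B g U0 U).

Definition shock_speed (U0 U : state) : R :=
  (height U * velocity U - height U0 * velocity U0) / (height U - height U0).

(** [Ut] is the state written U-tilde. *)
Definition is_tilde (g : R) (U Ut : state) : Prop :=
  shock_curve1 g U Ut /\ shock_speed U Ut = 0.

(** * Stationary waves *)

(** The bottom level along the stationary curve issued from [U0]. *)
Definition a_curve (g : R) (U0 : state) (h : R) : R :=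
  let u := height U0 * velocity U0 / h in
  bottom U0 + (u ^ 2 - velocity U0 ^ 2) / (2 * g) + h - height U0.

Definition phi (g : R) (U0 : state) (a h : R) : R :=
  bottom U0 - a
  + velocity U0 ^ 2 / (2 * g) * (height U0 ^ 2 / h ^ 2 - 1) + h - height U0.

Definition h_min (g : R) (U0 : state) : R :=
  Rpower (velocity U0 ^ 2 * height U0 ^ 2 / g) (1 / 3).

Definition a_min (g : R) (U0 : state) : R :=
  bottom U0
  + velocity U0 ^ 2 / (2 * g) * (height U0 ^ 2 / h_min g U0 ^ 2 - 1)
  + h_min g U0 - height U0.

Definition lower_root (g : R) (U0 : state) (a h : R) : Prop :=
  0 < h <= h_min g U0 /\ phi g U0 a h = 0.
Definition upper_root (g : R) (U0 : state) (a h : R) : Prop :=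
  0 < h /\ h_min g U0 <= h /\ phi g U0 a h = 0.

(** [SW g U0 a] is the set of states of bottom level [a] selected by a
    stationary wave from [U0]; it has two elements in general when [U0] is
    sonic. *)
Definition SW (g : R) (U0 : state) (a : R) (U : state) : Prop :=
  (velocity U0 <> 0 /\ a_min g U0 <= a /\
   bottom U = a /\ velocity U = height U0 * velocity U0 / height U /\
   (((A1 g U0 \/ A3 g U0) /\ lower_root g U0 a (height U)) \/
    (A2 g U0 /\ upper_root g U0 a (height U)) \/
    (C_sonic g U0 /\
     (lower_root g U0 a (height U) \/ upper_root g U0 a (height U)))))
  \/
  (velocity U0 = 0 /\ 0 < height U0 + bottom U0 - a /\
   U = mkState (height U0 + bottom U0 - a) 0 a).

(** Off the rest states the bottom level is required to follow [a_curve], the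
    relation whose solutions are the zeros of [phi].  Conservation of
    [u^2/2 + g (h + a)] would give [a] the opposite variation along this curve
    and is incompatible with [phi], [a_min] and [SW] as soon as the bottom level
    jumps; the two sign conventions cannot be mixed.  At rest, [h + a] is
    constant, in agreement with [SW]. *)
Definition stationary (g : R) (U0 U : state) : Prop :=
  height U * velocity U = height U0 * velocity U0 /\
  (velocity U0 <> 0 -> bottom U = a_curve g U0 (height U)) /\
  (velocity U0 = 0 -> height U + bottom U = height U0 + bottom U0).

(** * Wave fans *)

Inductive family := first | second.

Inductive wave :=
  | Shock (i : family) (U V : state)
  | Rarefaction (i : family) (U V : state)
  | Stationary (U V : state).

Definition left_state (w : wave) : state :=
  match w with Shock _ U _ | Rarefaction _ U _ | Stationary U _ => U end.
Definition right_state (w : wave) : state :=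
  match w with Shock _ _ V | Rarefaction _ _ V | Stationary _ V => V end.

Definition lambda (g : R) (i : family) : state -> R :=
  match i with first => lambda1 g | second => lambda2 g end.

(** Since [bottom] does not jump across a shock, the source term drops out. *)
Definition rankine_hugoniot (g : R) (U V : state) (s : R) : Prop :=
  bottom V = bottom U /\
  s * (height V - height U)
    = height V * velocity V - height U * velocity U /\
  s * (height V * velocity V - height U * velocity U)
    = height V * (velocity V ^ 2 + g * height V / 2)
      - height U * (velocity U ^ 2 + g * height U / 2).

Definition lax_inequalities (g : R) (i : family) (U V : state) (s : R) : Prop :=
  lambda g i V < s < lambda g i U /\
  match i with
  | first => s < lambda2 g V
  | second => lambda1 g U < s
  end.

Definition lax_shock (g : R) (i : family) (U V : state) : Prop :=
  match i with
  | first => shock_curve1 g U V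
  | second => shock_curve2B g V U
  end /\
  rankine_hugoniot g U V (shock_speed U V) /\
  lax_inequalities g i U V (shock_speed U V).

(** The trivial wave [U = V] is a degenerate rarefaction. *)
Definition rarefaction (g : R) (i : family) (U V : state) : Prop :=
  match i with
  | first => rarefaction_curve1 g U V
  | second => rarefaction_curve2B g V U
  end.

Definition wave_admissible (g : R) (w : wave) : Prop :=
  0 < height (left_state w) /\ 0 < height (right_state w) /\
  match w with
  | Shock i U V => lax_shock g i U V
  | Rarefaction i U V => rarefaction g i U V
  | Stationary U V => stationary g U V
  end.

Definition has_speed (g : R) (w : wave) (s : R) : Prop :=
  match w with
  | Shock _ U V => s = shock_speed U V
  | Rarefaction i U V => lambda g i U <= s <= lambda g i V
  | Stationary _ _ => s = 0
  end.

Definition precedes (g : R) (w w' : wave) : Prop :=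
  forall s s', has_speed g w s -> has_speed g w' s' -> s <= s'.

Fixpoint connects (U : state) (ws : list wave) (V : state) : Prop :=
  match ws with
  | [] => U = V
  | w :: ws' => left_state w = U /\ connects (right_state w) ws' V
  end.

Definition monotone_between (f : R -> R) (x y : R) : Prop :=
  let inside z := Rmin x y <= z <= Rmax x y in
  (forall z z', inside z -> inside z' -> z <= z' -> f z <= f z') \/
  (forall z z', inside z -> inside z' -> z <= z' -> f z' <= f z).

(** In a wave fan [a] is piecewise constant in [x/t], so that its total
    variation is the sum of the jumps. *)
Definition total_variation_a (ws : list wave) : R :=
  fold_right
    (fun w r => Rabs (bottom (right_state w) - bottom (left_state w)) + r) 0 ws.

Definition monotonicity_criterion (g : R) (UL UR : state) (ws : list wave)
    : Prop :=
  (forall U V, In (Stationary U V) ws ->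
     monotone_between (a_curve g U) (height U) (height V)) /\
  total_variation_a ws = Rabs (bottom UL - bottom UR).

Definition admissible_solution (g : R) (UL UR : state) (ws : list wave) : Prop :=
  connects UL ws UR /\
  Forall (wave_admissible g) ws /\
  ForallOrdPairs (precedes g) ws /\
  monotonicity_criterion g UL UR ws.

(** [w] is the wave of family [i], shock or rarefaction, from [U] to [V]. *)
Definition is_W (i : family) (U V : state) (w : wave) : Prop :=
  w = Shock i U V \/ w = Rarefaction i U V.

(* Main.v *)
(** A sonic state on [W1 UL] lies on its rarefaction part, since a 1-shock lowers
    [lambda1] and [lambda1 UL < 0]; so the first rarefaction ends exactly at
    speed 0.  The stationary curve has its minimum of [a] at the sonic depth, and
    the supercritical state [U1] lies on its decreasing branch.  The speed of a
    1-shock from [U1] decreases with the depth behind it and vanishes at the depth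
    of the state U-tilde, so [h2 <= h1-tilde] makes the third wave nonnegative.
    Finally the velocity [u2] separates the speeds of every 1-wave ending at [U2]
    from those of every 2-wave starting there. *)

Require Import Defs.
From Stdlib Require Import Lra Psatz.
Local Open Scope R_scope.

(** * The slope factor of the shock curves and its bounds *)

(** This is the velocity jump across a shock divided by the depth jump, up to sign. In the frame of
    the shock the fluid moves at speed [h * shock_slope g h0 h] on the side of depth [h0], and at
    [h0 * shock_slope g h0 h] on the side of depth [h]. *)
Definition shock_slope (g h0 h : R) : R := sqrt (g / 2) * sqrt (1 / h + 1 / h0).

Lemma shock_slope_pos (g h0 h : R) :
  0 < g -> 0 < h0 -> 0 < h -> 0 < shock_slope g h0 h.
Proof.
intros hg h0pos hpos.
apply Rmult_lt_0_compat; apply sqrt_lt_R0; [lra|].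
apply Rplus_lt_0_compat; apply Rdiv_lt_0_compat; lra.
Qed.

Lemma shock_slope_sqr (g h0 h : R) :
  0 < g -> 0 < h0 -> 0 < h ->
  2 * h * h0 * shock_slope g h0 h ^ 2 = g * (h + h0).
Proof.
intros hg h0pos hpos; unfold shock_slope.
rewrite Rpow_mult_distr, !pow2_sqrt; [field; lra | | lra].
apply Rlt_le, Rplus_lt_0_compat; apply Rdiv_lt_0_compat; lra.
Qed.

Lemma lt_of_sqr_lt (x y : R) : 0 < y -> x ^ 2 < y ^ 2 -> x < y.
Proof. intros ypos hlt; nra. Qed.

(** Supercriticality of the shallow side in the frame of the shock: after squaring, it amounts to
    [2 * h0 * h0 < h * (h + h0)]. *)
Lemma shock_slope_front (g h0 h : R) :
  0 < g -> 0 < h0 < h -> sqrt (g * h0) < h * shock_slope g h0 h.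
Proof.
intros hg hh.
assert (kpos := shock_slope_pos g h0 h hg ltac:(lra) ltac:(lra)).
assert (ksqr := shock_slope_sqr g h0 h hg ltac:(lra) ltac:(lra)).
set (k := shock_slope g h0 h) in *.
apply lt_of_sqr_lt; [nra|].
rewrite pow2_sqrt by nra.
apply Rmult_lt_reg_l with (2 * h0); [lra|].
replace (2 * h0 * (h * k) ^ 2) with (h * (2 * h * h0 * k ^ 2)) by ring.
rewrite ksqr.
assert (0 < g * (h * (h + h0) - 2 * h0 * h0)); [|nra].
apply Rmult_lt_0_compat; nra.
Qed.

(** Subcriticality of the deep side, by the dual inequality [h0 * (h + h0) < 2 * h * h]. *)
Lemma shock_slope_back (g h0 h : R) :
  0 < g -> 0 < h0 < h -> h0 * shock_slope g h0 h < sqrt (g * h).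
Proof.
intros hg hh.
assert (ksqr := shock_slope_sqr g h0 h hg ltac:(lra) ltac:(lra)).
set (k := shock_slope g h0 h) in *.
apply lt_of_sqr_lt; [apply sqrt_lt_R0; nra|].
rewrite pow2_sqrt by nra.
apply Rmult_lt_reg_l with (2 * h); [lra|].
replace (2 * h * (h0 * k) ^ 2) with (h0 * (2 * h * h0 * k ^ 2)) by ring.
rewrite ksqr.
assert (0 < g * (2 * h * h - h0 * (h + h0))); [|nra].
apply Rmult_lt_0_compat; nra.
Qed.

(** The square of the product is [g * h * (h + h0) / (2 * h0)], increasing in [h]. Hence the speed
    of a 1-shock from a fixed left state decreases with the depth behind it. *)
Lemma shock_slope_incr (g h0 h h' : R) :
  0 < g -> 0 < h0 -> 0 < h <= h' ->
  h * shock_slope g h0 h <= h' * shock_slope g h0 h'.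
Proof.
intros hg h0pos hh.
assert (kpos := shock_slope_pos g h0 h hg ltac:(lra) ltac:(lra)).
assert (ksqr := shock_slope_sqr g h0 h hg ltac:(lra) ltac:(lra)).
assert (kpos' := shock_slope_pos g h0 h' hg ltac:(lra) ltac:(lra)).
assert (ksqr' := shock_slope_sqr g h0 h' hg ltac:(lra) ltac:(lra)).
set (k := shock_slope g h0 h) in *; set (k' := shock_slope g h0 h') in *.
apply Rsqr_incr_0; [|nra|nra].
apply Rmult_le_reg_l with (2 * h0); [lra|]; unfold Rsqr.
replace (2 * h0 * (h * k * (h * k))) with (h * (2 * h * h0 * k ^ 2)) by ring.
replace (2 * h0 * (h' * k' * (h' * k'))) with (h' * (2 * h' * h0 * k' ^ 2)) by ring.
rewrite ksqr, ksqr'.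
assert (0 <= g * (h' * (h' + h0) - h * (h + h0))); [|nra].
apply Rmult_le_pos; nra.
Qed.

(** * Shock speeds and Lax admissibility *)

Lemma shock_curve1_velocity (g : R) (U0 U : state) :
  shock_curve1 g U0 U ->
  velocity U = velocity U0
    - (height U - height U0) * shock_slope g (height U0) (height U).
Proof. intros (_ & _ & ->); unfold shock_slope; ring. Qed.

Lemma shock_curve2B_velocity (g : R) (U0 U : state) :
  shock_curve2B g U0 U ->
  velocity U = velocity U0
    + (height U - height U0) * shock_slope g (height U0) (height U).
Proof. intros (_ & _ & ->); unfold shock_slope; ring. Qed.

Lemma shock_speed1 (g : R) (U0 U : state) :
  shock_curve1 g U0 U ->
  shock_speed U0 U
    = velocity U0 - height U * shock_slope g (height U0) (height U).
Proof.
intros hS; assert (hu := shock_curve1_velocity _ _ _ hS).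
destruct hS as (hlt & _); unfold shock_speed; rewrite hu; field; lra.
Qed.

Lemma shock_speed2 (g : R) (U0 U : state) :
  shock_curve2B g U0 U ->
  shock_speed U U0
    = velocity U0 + height U * shock_slope g (height U0) (height U).
Proof.
intros hS; assert (hu := shock_curve2B_velocity _ _ _ hS).
destruct hS as (hlt & _); unfold shock_speed; rewrite hu; field; lra.
Qed.

(** The front and back bounds are the two [lambda1] inequalities read in the frame of the shock; the
    bound by [lambda2 g U] follows since the fluid behind is faster than the shock by
    [height U0 * k]. *)
Lemma shock_curve1_lax (g : R) (U0 U : state) :
  0 < g -> 0 < height U0 -> shock_curve1 g U0 U -> lax_shock g first U0 U.
Proof.
intros hg h0pos hS.
assert (hu := shock_curve1_velocity _ _ _ hS).
assert (hs := shock_speed1 _ _ _ hS).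
split; [exact hS|]; destruct hS as (hlt & ha & _).
assert (hpos : 0 < height U) by lra.
assert (kpos := shock_slope_pos _ _ _ hg h0pos hpos).
assert (ksqr := shock_slope_sqr _ _ _ hg h0pos hpos).
assert (kf := shock_slope_front _ _ _ hg (conj h0pos hlt)).
assert (kb := shock_slope_back _ _ _ hg (conj h0pos hlt)).
set (k := shock_slope g (height U0) (height U)) in *.
split.
- split; [exact ha|]; rewrite hs, hu; split; [ring|].
  (* The defect in the momentum relation is a multiple of the identity [ksqr]. *)
  apply Rminus_diag_uniq.
  transitivity ((height U - height U0) / 2
    * (2 * height U * height U0 * k ^ 2 - g * (height U + height U0)));
    [field | rewrite ksqr; ring].
- assert (0 <= sqrt (g * height U)) by apply sqrt_pos.
  unfold lax_inequalities, lambda, lambda1, lambda2; rewrite hs, hu.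
  repeat split; nra.
Qed.

Lemma shock_curve2B_lax (g : R) (U0 U : state) :
  0 < g -> 0 < height U0 -> shock_curve2B g U0 U -> lax_shock g second U U0.
Proof.
intros hg h0pos hS.
assert (hu := shock_curve2B_velocity _ _ _ hS).
assert (hs := shock_speed2 _ _ _ hS).
split; [exact hS|]; destruct hS as (hlt & ha & _).
assert (hpos : 0 < height U) by lra.
assert (kpos := shock_slope_pos _ _ _ hg h0pos hpos).
assert (ksqr := shock_slope_sqr _ _ _ hg h0pos hpos).
assert (kf := shock_slope_front _ _ _ hg (conj h0pos hlt)).
assert (kb := shock_slope_back _ _ _ hg (conj h0pos hlt)).
set (k := shock_slope g (height U0) (height U)) in *.
split.
- split; [congruence|]; rewrite hs, hu; split; [ring|].
  apply Rminus_diag_uniq.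
  transitivity ((height U0 - height U) / 2
    * (2 * height U * height U0 * k ^ 2 - g * (height U + height U0)));
    [field | rewrite ksqr; ring].
- assert (0 <= sqrt (g * height U)) by apply sqrt_pos.
  unfold lax_inequalities, lambda, lambda1, lambda2; rewrite hs, hu.
  repeat split; nra.
Qed.

(** * Rarefactions and the sonic point of the first wave curve *)

(** The Riemann invariant [u + 2 * sqrt (g * h)] is constant along the curve, so [lambda1] is a
    constant minus [3 * sqrt (g * h)], while the depth drops. *)
Lemma rarefaction_curve1_lambda1 (g : R) (U0 U : state) :
  0 < g -> rarefaction_curve1 g U0 U -> lambda1 g U0 <= lambda1 g U.
Proof.
intros hg (hh & _ & hu); unfold lambda1; rewrite hu, !sqrt_mult by lra.
assert (sqrt (height U) <= sqrt (height U0)) by (apply sqrt_le_1; lra).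
assert (0 <= sqrt g) by apply sqrt_pos.
nra.
Qed.

Lemma W1_bottom (g : R) (U0 U : state) : W1 g U0 U -> bottom U = bottom U0.
Proof. intros (_ & [(_ & ? & _) | (_ & ? & _)]); assumption. Qed.

Lemma W1_sonic_rarefaction (g : R) (U0 U : state) :
  0 < g -> 0 < height U0 -> lambda1 g U0 < 0 -> W1 g U0 U -> C_plus g U ->
  rarefaction_curve1 g U0 U.
Proof.
intros hg h0pos hl (_ & [hS | hR]) (_ & hC); [exfalso | exact hR].
destruct (shock_curve1_lax _ _ _ hg h0pos hS) as (_ & _ & (hlax & _)).
unfold lambda in hlax.
assert (lambda1 g U = 0) by (unfold lambda1; lra).
lra.
Qed.

(** * The stationary wave issued from a sonic state *)

(** [phi g U0 a] equals [a_curve g U0] minus [a], so a root on either branch places the bottom level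
    on the curve; the nonzero velocity excludes the rest case. *)
Lemma SW_stationary (g : R) (U0 U : state) (a : R) :
  0 < g -> 0 < height U -> velocity U0 <> 0 ->
  SW g U0 a U -> bottom U = a /\ stationary g U0 U.
Proof.
intros hg hpos hu0 [(_ & _ & ha & hu & hroot) | (hu & _)]; [|contradiction].
assert (hphi : phi g U0 a (height U) = 0)
  by (unfold lower_root, upper_root in hroot; tauto).
split; [exact ha|]; split; [|split].
- rewrite hu; field; lra.
- intros _; rewrite ha; unfold phi in hphi; unfold a_curve.
  apply Rminus_diag_uniq; rewrite <- Ropp_0, <- hphi; field; lra.
- contradiction.
Qed.

(** Were [U] at least as deep as [U0], its supercritical velocity would exceed that of [U0], and so
    would its discharge. *)
Lemma sonic_to_A1_height (g : R) (U0 U : state) :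
  0 < g -> C_plus g U0 -> A1 g U ->
  height U * velocity U = height U0 * velocity U0 -> height U < height U0.
Proof.
intros hg (h0pos & hC) (hpos & hl & _) hq; unfold lambda1 in hl.
apply Rnot_le_lt; intros hle.
assert (sqrt (g * height U0) <= sqrt (g * height U)) by (apply sqrt_le_1; nra).
assert (0 < sqrt (g * height U0)) by (apply sqrt_lt_R0; nra).
nra.
Qed.

Lemma a_curve_sonic_decreasing (g : R) (U0 : state) (z z' : R) :
  0 < g -> C_plus g U0 -> 0 < z <= z' -> z' <= height U0 ->
  a_curve g U0 z' <= a_curve g U0 z.
Proof.
intros hg (h0pos & hC) hz hz'.
assert (hu2 : velocity U0 ^ 2 = g * height U0)
  by (rewrite hC; apply pow2_sqrt; nra).
unfold a_curve; set (h := height U0) in *.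
(* The sonic relation [hu2] eliminates [g] from the kinetic term. *)
assert (E : forall y, 0 < y ->
  ((h * velocity U0 / y) ^ 2 - velocity U0 ^ 2) / (2 * g) = (h ^ 3 / y ^ 2 - h) / 2).
{ intros y hy; replace ((h * velocity U0 / y) ^ 2)
    with (h ^ 2 * velocity U0 ^ 2 / y ^ 2) by (field; lra).
  rewrite hu2; field; lra. }
rewrite !E by lra.
(* Factored form of the drop of [a_curve] from [z] to [z']. Its sign comes from bounding both
   [z * z' * z] and [z * z' * z'] by [h ^ 3]. *)
assert (D : 0 <= (z' - z) * (h ^ 3 * (z + z') - 2 * z ^ 2 * z' ^ 2)
              / (2 * z ^ 2 * z' ^ 2)).
{ apply Rmult_le_pos.
  - apply Rmult_le_pos; [lra|].
    assert (z * z' <= h * h) by nra.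
    assert (z * z' * z <= h * h * h) by (apply Rmult_le_compat; nra).
    assert (z * z' * z' <= h * h * h) by (apply Rmult_le_compat; nra).
    assert (z' * (z * z' * z) <= z' * (h * h * h)) by (apply Rmult_le_compat_l; lra).
    assert (z * (z * z' * z') <= z * (h * h * h)) by (apply Rmult_le_compat_l; lra).
    nra.
  - apply Rlt_le, Rinv_0_lt_compat.
    assert (0 < z ^ 2) by (apply pow_lt; lra).
    assert (0 < z' ^ 2) by (apply pow_lt; lra).
    nra. }
match goal with |- ?x <= ?y => assert (y - x
  = (z' - z) * (h ^ 3 * (z + z') - 2 * z ^ 2 * z' ^ 2) / (2 * z ^ 2 * z' ^ 2))
  by (field; lra) end.
lra.
Qed.

(** * Locating the speeds of the last two waves *)

(** A 1-shock is compared with the zero-speed shock to [Ut]; a 1-rarefaction starts at a positive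
    [lambda1]. Both trail the fluid at [U]. The separate clause [0 <= velocity U] serves to order
    the zero-speed waves before the 2-wave. *)
Lemma W1_wave (g : R) (U0 U Ut : state) :
  0 < g -> A1 g U0 -> is_tilde g U0 Ut -> W1 g U0 U -> height U <= height Ut ->
  exists w, is_W first U0 U w /\ wave_admissible g w /\ 0 <= velocity U /\
    forall s, has_speed g w s -> 0 <= s <= velocity U.
Proof.
intros hg (h0pos & hl & _) (hSt & hst) (hpos & [hS | hR]) hle.
- exists (Shock first U0 U).
  assert (hs := shock_speed1 _ _ _ hS).
  assert (hu := shock_curve1_velocity _ _ _ hS).
  rewrite (shock_speed1 _ _ _ hSt) in hst.
  assert (kpos := shock_slope_pos _ _ _ hg h0pos hpos).
  assert (kle := shock_slope_incr g (height U0) _ _ hg h0pos (conj hpos hle)).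
  assert (0 <= shock_speed U0 U <= velocity U) by (rewrite hs, hu; nra).
  split; [left; reflexivity|]; split; [|split].
  + split; [exact h0pos|]; split; [exact hpos|].
    exact (shock_curve1_lax _ _ _ hg h0pos hS).
  + lra.
  + simpl; intros s ->; assumption.
- exists (Rarefaction first U0 U).
  assert (hle1 := rarefaction_curve1_lambda1 _ _ _ hg hR).
  assert (0 <= sqrt (g * height U)) by apply sqrt_pos.
  assert (hlu : lambda1 g U <= velocity U) by (unfold lambda1; lra).
  split; [right; reflexivity|]; split; [|split].
  + split; [exact h0pos|]; split; [exact hpos | exact hR].
  + lra.
  + simpl; intros s hs; lra.
Qed.

(** Every 2-wave outruns the fluid at its left state: a shock by [height U0] times the slope factor,
    a rarefaction by at least [sqrt (g * height U)]. *)
Lemma W2B_wave (g : R) (U0 U : state) :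
  0 < g -> 0 < height U0 -> W2B g U0 U ->
  bottom U = bottom U0 /\
  exists w, is_W second U U0 w /\ wave_admissible g w /\
    forall s, has_speed g w s -> velocity U <= s.
Proof.
intros hg h0pos (hpos & [hS | hR]).
- split; [exact (proj1 (proj2 hS))|].
  exists (Shock second U U0); split; [left; reflexivity|]; split.
  + split; [exact hpos|]; split; [exact h0pos|].
    exact (shock_curve2B_lax _ _ _ hg h0pos hS).
  + simpl; intros s ->.
    rewrite (shock_speed2 _ _ _ hS), (shock_curve2B_velocity _ _ _ hS).
    assert (kpos := shock_slope_pos _ _ _ hg h0pos hpos); nra.
- split; [exact (proj1 (proj2 hR))|].
  exists (Rarefaction second U U0); split; [right; reflexivity|]; split.
  + split; [exact hpos|]; split; [exact h0pos | exact hR].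
  + simpl; intros s (hs & _).
    assert (0 <= sqrt (g * height U)) by apply sqrt_pos.
    unfold lambda2 in hs; lra.
Qed.

(** * Assembly of the wave fan *)

Lemma is_W_states (i : family) (U V : state) (w : wave) :
  is_W i U V w ->
  left_state w = U /\ right_state w = V /\ forall X Y, w <> Stationary X Y.
Proof. intros [-> | ->]; repeat split; discriminate. Qed.

Theorem theorem4p5 (g : R) (hg : 0 < g) (UL UR Up U1 U2 Ut1 : state)
  (hUR : 0 < height UR)
  (hUL : A2 g UL \/ A3 g UL)
  (ha : bottom UL < bottom UR)
  (hUp : forall U, (W1 g UL U /\ C_plus g U) <-> U = Up)
  (hU1 : forall U, (SW g Up (bottom UR) U /\ A1 g U) <-> U = U1)
  (hU2 : forall U, (W1 g U1 U /\ W2B g UR U) <-> U = U2)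
  (hUt1 : is_tilde g U1 Ut1)
  (hle : height U2 <= height Ut1) :
  exists w12 w2R : wave,
    is_W first U1 U2 w12 /\ is_W second U2 UR w2R /\
    admissible_solution g UL UR
      [Rarefaction first UL Up; Stationary Up U1; w12; w2R].
Proof.
destruct (proj2 (hUp Up) eq_refl) as (hWp & hCp).
destruct (proj2 (hU1 U1) eq_refl) as (hSW & hA1).
destruct (proj2 (hU2 U2) eq_refl) as (hW2 & hWB).
assert (hL : 0 < height UL) by (destruct hUL as [(? & _) | (? & _)]; assumption).
assert (hlL : lambda1 g UL < 0)
  by (destruct hUL as [(_ & ? & _) | (_ & ? & ?)]; lra).
assert (hRp := W1_sonic_rarefaction _ _ _ hg hL hlL hWp hCp).
assert (hlp : lambda1 g Up = 0) by (unfold lambda1; destruct hCp; lra).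
assert (hp : 0 < height Up) by apply hCp.
assert (h1 : 0 < height U1) by apply hA1.
assert (hup : velocity Up <> 0).
{ destruct hCp as (_ & ->); apply Rgt_not_eq, sqrt_lt_R0, Rmult_lt_0_compat; lra. }
destruct (SW_stationary _ _ _ _ hg h1 hup hSW) as (hb1 & hst).
assert (hlt := sonic_to_A1_height _ _ _ hg hCp hA1 (proj1 hst)).
destruct (W1_wave _ _ _ _ hg hA1 hUt1 hW2 hle) as (w12 & hw12 & had12 & hu2 & hs12).
destruct (W2B_wave _ _ _ hg hUR hWB) as (hb2 & w2R & hw2R & had2R & hs2R).
destruct (is_W_states _ _ _ _ hw12) as (hl12 & hr12 & hn12).
destruct (is_W_states _ _ _ _ hw2R) as (hl2R & hr2R & hn2R).
exists w12, w2R; split; [exact hw12|]; split; [exact hw2R|].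
split; [|split; [|split; [|split]]].
- simpl; repeat split; congruence.
- repeat apply Forall_cons; try apply Forall_nil; try assumption;
    (split; [assumption|]; split; [assumption|]; assumption).
(* All six pairs are separated by [0] or by [velocity U2]: [hlp] ends the first rarefaction at [0],
   and [hu2] places [velocity U2] to the right of [0]. *)
- repeat first [apply FOP_nil | apply FOP_cons | apply Forall_nil | apply Forall_cons];
    intros s s' hs hs'; simpl in hs, hs';
    repeat match goal with
    | H : has_speed g w12 _ |- _ => apply hs12 in H
    | H : has_speed g w2R _ |- _ => apply hs2R in H
    end; lra.
- intros U V [hin | [hin | [hin | [hin | []]]]].
  + discriminate.
  + injection hin as <- <-; right; intros z z'.
    (* By [hlt] the interval runs from [height U1] up to the sonic depth [height Up]. *)
    rewrite Rmin_right, Rmax_left by lra; intros hz hz' hzz.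
    apply a_curve_sonic_decreasing; [exact hg | exact hCp | lra | lra].
  + exfalso; exact (hn12 _ _ hin).
  + exfalso; exact (hn2R _ _ hin).
- unfold total_variation_a; cbn [fold_right left_state right_state].
  (* The bottom jumps only across the stationary wave, so the sum reduces to that jump. *)
  rewrite hl12, hr12, hl2R, hr2R, hb1, hb2, (W1_bottom _ _ _ hWp).
  rewrite !Rminus_diag, Rabs_R0, (Rabs_minus_sym (bottom UR)); ring.
Qed.
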